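(* Let $f:\mathbb{R}^n\to\mathbb{R}\cup\{\infty\}$ be convex and differentiable, let $X\subseteq\mathrm{dom}(f)$ be convex, and let $h:\mathbb{R}^n\to\mathbb{R}\cup\{\infty\}$ be convex and differentiable on $X$, with Bregman distance $D_h$. Suppose $f^\star:=\min_{x\in X}f(x)$ is finite, $X^\star:=\{x\in X:f(x)=f^\star\}\ne\emptyset$, and the map $x\mapsto\bar x:=\mathrm{argmin}_{y\in X^\star}D_h(y,x)$ is well defined for all $x\in X$. Suppose $L:=L_{f,X,D_h}<\infty$ and $\mu:=\mu^\star_{f,X,D_h}>0$. Let $x_0\in X$ and let $x_k$, $k=0,1,\dots$, be the iterates generated by the mirror descent algorithm \[ x_{k+1}=\mathrm{argmin}_{y\in X}\{\langle\nabla f(x_k),y\rangle+L_k\,D_h(y,x_k)\},\qquad k=0,1,\dots \] with $L_k=L$ for $k=0,1,\dots$. Then \[ D_h(X^\star,x_k)\le\left(1-\frac{\mu}{L}\right)^kD_h(X^\star,x_0)\quad\text{for }k=0,1,\dots \] and \[ f(x_k)-f^\star\le L\left(1-\frac{\mu}{L}\right)^kD_h(X^\star,x_0)\quad\text{for }k=1,2,\dots. \]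
   Context: Bregman distances: $D_f(y,x)=f(y)-f(x)-\langle\nabla f(x),y-x\rangle$ and likewise $D_h(y,x)=h(y)-h(x)-\langle\nabla h(x),y-x\rangle$ for $x,y\in X$; $D_h(X^\star,x):=\inf_{y\in X^\star}D_h(y,x)$. The Bregman proximal map $g\mapsto\mathrm{argmin}_{y\in X}\{\langle g,y\rangle+L\,D_h(y,x)\}$ is assumed computable for $x\in X$ and $L>0$; the algorithm's parameters satisfy $L_k>0$. Relative smoothness constant and relative quasi-strong convexity constant: \[ L_{f,X,D_h}:=\inf\{L>0:\ D_f(y,x)\le L\,D_h(y,x)\ \forall x,y\in X\}, \] \[ \mu^\star_{f,X,D_h}:=\sup\{\mu\ge0:\ D_f(\bar x,x)\ge\mu\,D_h(\bar x,x)\ \forall x\in X\}. \] *)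

(* Defs.v *)
(* R^n is 'rV[R]_n, and a function
   R^n -> R u {oo} is a map 'rV[R]_n -> \bar R that never takes the value -oo. *)
From HB Require Import structures.
From mathcomp Require Import all_boot all_order all_algebra.
From mathcomp Require Import all_classical all_reals all_analysis.

Set Implicit Arguments.
Unset Strict Implicit.
Unset Printing Implicit Defensive.

Import Order.TTheory GRing.Theory Num.Theory.
Import numFieldNormedType.Exports.

Local Open Scope classical_set_scope.
Local Open Scope ring_scope.
Local Open Scope ereal_scope.

Section BregmanDefs.
Context {R : realType} {n : nat}.
Local Notation E := 'rV[R]_n.
Implicit Types (f h : E -> \bar R) (X S : set E) (x y : E).

Definition dotp x y : R := (\sum_(i < n) x ord0 i * y ord0 i)%R.

Definition edom f : set E := [set x | f x < +oo].

(* The products with t = 0 or t = 1 use the convention 0 * oo = 0. *)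
Definition econvex_on S f : Prop :=
  forall x y (t : R), S x -> S y -> (0 <= t <= 1)%R ->
    f (t *: x + (1 - t) *: y)%R <= t%:E * f x + (1 - t)%:E * f y.

(* Finiteness near x makes x an interior point of the domain; without it,
   [fine], which sends +oo to 0, would hide infinite values around x. *)
Definition edifferentiable f x : Prop :=
  (\forall z \near x, f z \is a fin_num) /\ differentiable (fine \o f) x.

Definition egradient f x : E :=
  (\row_(i < n) 'D_(delta_mx ord0 i) (fine \o f) x)%R.

Definition bregman f y x : \bar R :=
  f y - f x - (dotp (egradient f x) (y - x)%R)%:E.

Definition argmin S (phi : E -> \bar R) : set E :=
  [set y | S y /\ forall z, S z -> phi y <= phi z].

Definition minval f X : \bar R := ereal_inf (f @` X).

Definition solset f X : set E := [set x | X x /\ f x = minval f X].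

Definition bregman_dist h S x : \bar R :=
  ereal_inf [set bregman h y x | y in S].

(* Arbitrary when there is no minimizer, and a chosen minimizer when there are
   several. *)
Definition bregman_proj h S x : E := get (argmin S (bregman h ^~ x)).

Definition rel_smoothness f X h : \bar R :=
  ereal_inf (EFin @` [set L : R | (0 < L)%R /\
    forall x y, X x -> X y -> bregman f y x <= L%:E * bregman h y x]).

Definition rel_quasi_strong_convexity f X h : \bar R :=
  ereal_sup (EFin @` [set mu : R | (0 <= mu)%R /\
    forall x, X x -> let xbar := bregman_proj h (solset f X) x in
      mu%:E * bregman h xbar x <= bregman f xbar x]).

Definition mirror_descent f X h (Lk : nat -> R) (x : nat -> E) : Prop :=
  forall k, argmin X
    (fun y => (dotp (egradient f (x k)) y)%:E + (Lk k)%:E * bregman h y (x k))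
    (x k.+1).

End BregmanDefs.

(* Main.v *)
Require Import Defs.
From HB Require Import structures.
From mathcomp Require Import all_boot all_order all_algebra.
From mathcomp Require Import all_classical all_reals all_analysis.
From mathcomp Require Import ring lra.

(** Optimality of [x_{k+1}] on the convex set [X] gives the three-point
    inequality, for [g] the gradient of [f] at [x_k] and every [y] in [X],
    [<g, x_{k+1}> + L D_h(x_{k+1}, x_k) + L D_h(y, x_{k+1})
       <= <g, y> + L D_h(y, x_k)].
    Adding relative smoothness at [(x_{k+1}, x_k)] and taking for [y] the
    projection [xbar_k] of [x_k] on [X*] yields
    [L D_h(X*, x_{k+1}) + (f x_{k+1} - f* ) + D_f(xbar_k, x_k)
       <= L D_h(X*, x_k)],
    and relative quasi-strong convexity bounds [D_f(xbar_k, x_k)] below by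
    [mu D_h(X*, x_k)]. *)

Set Implicit Arguments.
Unset Strict Implicit.
Unset Printing Implicit Defensive.

Import Order.TTheory GRing.Theory Num.Theory.
Import numFieldNormedType.Exports.

Local Open Scope classical_set_scope.
Local Open Scope ring_scope.
Local Open Scope ereal_scope.

(** * Directional derivatives bounded through one-sided difference quotients *)

Section DirectionalDerivative.
Context {R : realType} {V : normedModType R}.
Implicit Types (F : V -> R) (x v : V) (c : R).
Local Open Scope ring_scope.

(** The two-sided limit of the difference quotient equals its right-hand limit, for which small
    positive [t] suffice. The range [0 < t < 1] is where a segment leaving [x] stays in a convex
    set. *)
Lemma derive_ge F x v c : derivable F x v ->
  (forall t : R, 0 < t < 1 -> t * c <= F (t *: v + x) - F x) ->
  c <= 'D_v F x.
Proof.
move=> dF leF; rewrite /derive cvg_at_rightE//.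
apply: limr_ge; first by apply: cvgP; apply: cvg_dnbhs_at_right; exact: dF.
near=> t.
have t0 : 0 < t by near: t; exact: nbhs_right_gt.
have t1 : t < 1 by near: t; exact: nbhs_right_lt.
by rewrite /= ler_pdivlMl// leF// t0 t1.
Unshelve. all: by end_near. Qed.

Lemma derive_le F x v c : derivable F x v ->
  (forall t : R, 0 < t < 1 -> F (t *: v + x) - F x <= t * c) ->
  'D_v F x <= c.
Proof.
move=> dF leF; rewrite -lerN2 -deriveN//; apply: derive_ge.
  exact: derivableN.
by move=> t t01; rewrite mulrN /= -opprD lerN2 leF.
Qed.

End DirectionalDerivative.

(** * The gradient as a linear form, and segments in convex sets *)

Section Dotp.
Context {R : realType} {n : nat}.
Implicit Types (x y z : 'rV[R]_n) (f : 'rV[R]_n -> \bar R).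
Local Open Scope ring_scope.

Lemma dotpBr x y z : dotp x (y - z) = dotp x y - dotp x z.
Proof.
by rewrite /dotp -sumrB; apply: eq_bigr => i _; rewrite !mxE mulrBr.
Qed.

Lemma dotpDr x y z : dotp x (y + z) = dotp x y + dotp x z.
Proof.
by rewrite /dotp -big_split; apply: eq_bigr => i _; rewrite !mxE mulrDr.
Qed.

Lemma dotpZr t x y : dotp x (t *: y) = t * dotp x y.
Proof.
by rewrite /dotp mulr_sumr; apply: eq_bigr => i _; rewrite !mxE mulrCA.
Qed.

(** [egradient] records partial derivatives only; differentiability makes the derivative linear in
    [v], so expanding [v] in the canonical basis recovers every direction. *)
Lemma dotp_egradient f x v : edifferentiable f x ->
  dotp (egradient f x) v = 'D_v (fine \o f) x.
Proof.
move=> [_ df]; rewrite deriveE// [in RHS](row_sum_delta v) linear_sum.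
apply: eq_bigr => i _.
by rewrite mxE linearZ /= -[in RHS]deriveE// mulrC.
Qed.

End Dotp.

Lemma addrZB_conv (R : pzRingType) (V : lmodType R) (x y : V) (t : R) :
  (t *: (y - x) + x = t *: y + (1 - t) *: x)%R.
Proof. by rewrite scalerBr scalerBl scale1r -addrA [(- _ + _)%R]addrC. Qed.

Lemma convex_setP (R : realType) (n : nat) (X : set 'rV[R]_n) :
  convex_set X -> forall x y (t : R), X x -> X y -> (0 < t < 1)%R ->
  X (t *: (y - x) + x)%R.
Proof.
move=> cX x y t Xx Xy /andP[t0 t1].
have := cX y x (Itv01 (ltW t0) (ltW t1)); rewrite !inE => /(_ Xy Xx).
by rewrite addrZB_conv.
Qed.

(** * Bregman distances of a convex function and the three-point inequality *)

Section Bregman.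
Context {R : realType} {n : nat}.
Implicit Types (f h : 'rV[R]_n -> \bar R) (X : set 'rV[R]_n).

(** A real-valued copy of [bregman], open to linear arithmetic; it is meaningful only where [f] is
    finite, since [fine] sends infinite values to 0. *)
Definition bregmanr f y x : R :=
  (fine (f y) - fine (f x) - dotp (egradient f x) (y - x))%R.

Lemma bregmanE f y x : f y \is a fin_num -> f x \is a fin_num ->
  bregman f y x = (bregmanr f y x)%:E.
Proof. by move=> fy fx; rewrite /bregman -(fineK fy) -(fineK fx). Qed.

Lemma edifferentiable_fin f x : edifferentiable f x -> f x \is a fin_num.
Proof. by move=> [/nbhs_singleton]. Qed.

Section BregmanConvex.
Variables (h : 'rV[R]_n -> \bar R) (X : set 'rV[R]_n).
Hypothesis X_convex : convex_set X.
Hypothesis h_diff : forall x, X x -> edifferentiable h x.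

Let h_fin x : X x -> h x \is a fin_num.
Proof. by move=> /h_diff; exact: edifferentiable_fin. Qed.

(** Convexity bounds the difference quotients of [h] from [x] towards [y] by [h y - h x], and the
    pairing with the gradient is their limit. *)
Lemma bregmanr_ge0 x y : econvex_on X h -> X x -> X y ->
  (0 <= bregmanr h y x)%R.
Proof.
move=> h_convex Xx Xy; rewrite /bregmanr subr_ge0 dotp_egradient; last exact: h_diff.
apply: derive_le; first by apply: diff_derivable; have [] := h_diff Xx.
move=> t t01 /=; have [/ltW t0 /ltW t1] := andP t01.
have Xw := convex_setP X_convex Xx Xy t01.
have := h_convex _ _ t Xy Xx; rewrite t0 t1 => /(_ isT).
rewrite -addrZB_conv -(fineK (h_fin Xx)) -(fineK (h_fin Xy)) -(fineK (h_fin Xw)) lee_fin /=.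
lra.
Qed.

(** First-order optimality of [z]: the objective does not decrease from [z] towards [y], so
    [g + l (grad h z - grad h x)] pairs nonnegatively with [y - z]. The three Bregman terms differ
    exactly by the [grad h] part of this pairing. *)
Lemma three_point (g x y z : 'rV[R]_n) (l : R) : (0 < l)%R -> X x -> X y ->
  argmin X (fun y => (dotp g y)%:E + l%:E * bregman h y x) z ->
  (dotp g z + l * bregmanr h z x + l * bregmanr h y z
    <= dotp g y + l * bregmanr h y x)%R.
Proof.
move=> l0 Xx Xy [Xz zmin].
(* The optimality condition solved for [grad h z], so that [derive_ge] applies to [h] alone instead
   of the whole objective. *)
have : (dotp (egradient h x) (y - z) - l^-1 * dotp g (y - z)
    <= dotp (egradient h z) (y - z))%R.
  rewrite [leRHS]dotp_egradient; last exact: h_diff.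
  apply: derive_ge; first by apply: diff_derivable; have [] := h_diff Xz.
  move=> t t01; have Xw := convex_setP X_convex Xz Xy t01.
  have := zmin _ Xw; rewrite !bregmanE ?h_fin// lee_fin /bregmanr /= => zw.
  rewrite -(ler_pM2l l0) [in leLHS]mulrCA [in leLHS](mulrBr l) mulVKf ?gt_eqF//.
  by move: zw; rewrite !dotpBr !dotpDr !dotpZr !dotpBr; lra.
rewrite -(ler_pM2l l0) mulrBr mulVKf ?gt_eqF// /bregmanr !dotpBr; lra.
Qed.

End BregmanConvex.
End Bregman.

Lemma argmin_ereal_inf (R : realType) (n : nat) (S : set 'rV[R]_n)
    (phi : 'rV[R]_n -> \bar R) y :
  argmin S phi y -> ereal_inf [set phi z | z in S] = phi y.
Proof.
move=> [Sy ymin]; apply/eqP; rewrite eq_le; apply/andP; split.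
  by apply: ereal_inf_lbound; exists y.
by apply/ereal_infP => _ [z Sz <-]; exact: ymin.
Qed.

(** * The relative constants satisfy their own defining inequalities *)

Section RelativeConstants.
Context {R : realType} {n : nat}.
Variables (f h : 'rV[R]_n -> \bar R) (X : set 'rV[R]_n).
Hypothesis f_fin : forall x, X x -> f x \is a fin_num.
Hypothesis h_fin : forall x, X x -> h x \is a fin_num.

(** The infimum is itself admissible because the inequality is closed in the constant: constants
    slightly above [l] are admissible, and the slack tends to 0. *)
Lemma bregmanr_smooth (l : R) x y : l%:E = rel_smoothness f X h ->
  X x -> X y -> (0 <= bregmanr h y x)%R ->
  (bregmanr f y x <= l * bregmanr h y x)%R.
Proof.
move=> lE Xx Xy D0; apply/ler_addgt0Pr => e e0.
(* Adding 1 keeps the divisor positive when the distance vanishes; the excess [e / (D + 1)] times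
   [D] is then at most [e]. *)
have D1 : (0 < bregmanr h y x + 1)%R by exact: ltr_wpDl.
have : rel_smoothness f X h < (l + e / (bregmanr h y x + 1))%:E.
  by rewrite -lE lte_fin ltrDl divr_gt0.
move=> /ereal_inf_lt[_ [l' [l'0 l'P] <-]]; rewrite lte_fin => /ltW l'l.
have := l'P _ _ Xx Xy; rewrite !bregmanE ?h_fin ?f_fin// lee_fin.
move=> /le_trans; apply; apply: (le_trans (ler_wpM2r D0 l'l)).
by rewrite mulrDl lerD2l mulrAC ler_pdivrMr// ler_wpM2l ?lerDl// ltW.
Qed.

(** The product stays in the extended reals because the supremum may be [+oo]. Nonnegativity comes
    from any single admissible constant, which exists since the supremum is positive. *)
Lemma bregmanr_qsc (xbar := bregman_proj h (solset f X)) x :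
  0 < rel_quasi_strong_convexity f X h ->
  X x -> X (xbar x) -> (0 <= bregmanr h (xbar x) x)%R ->
  (0 <= bregmanr f (xbar x) x)%R /\
  rel_quasi_strong_convexity f X h * (bregmanr h (xbar x) x)%:E
    <= (bregmanr f (xbar x) x)%:E.
Proof.
move=> mu0 Xx Xxb D0.
have qP m : (forall x, X x ->
    m%:E * bregman h (xbar x) x <= bregman f (xbar x) x) ->
    (m * bregmanr h (xbar x) x <= bregmanr f (xbar x) x)%R.
  by move=> /(_ _ Xx); rewrite !bregmanE ?h_fin ?f_fin// lee_fin.
have d0 : (0 <= bregmanr f (xbar x) x)%R.
  have [_ [m [m0 mP] <-] _] := ereal_sup_gt mu0.
  by apply: le_trans (qP _ mP); rewrite mulr_ge0.
(* At distance 0 the product is 0 even for an infinite constant. Otherwise the ratio of the two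
   distances bounds every admissible constant, hence the supremum. *)
split => //; have [->|Dn0] := eqVneq (bregmanr h (xbar x) x) 0%R.
  by rewrite mule0 lee_fin.
have {D0}D0 : (0 < bregmanr h (xbar x) x)%R by rewrite lt_neqAle eq_sym Dn0.
rewrite -lee_pdivlMr//; apply/ereal_supP => _ [m [m0 mP] <-].
by rewrite lee_fin ler_pdivlMr// qP.
Qed.

End RelativeConstants.

(** * One step of mirror descent, and the rate obtained by iterating it *)

Section MirrorDescent.
Context {R : realType} {n : nat}.
Variables (f h : 'rV[R]_n -> \bar R) (X : set 'rV[R]_n).
Hypothesis X_convex : convex_set X.
Hypothesis f_fin : forall x, X x -> f x \is a fin_num.
Hypothesis h_convex : econvex_on X h.
Hypothesis h_diff : forall x, X x -> edifferentiable h x.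

Let h_fin x : X x -> h x \is a fin_num.
Proof. by move=> /h_diff; exact: edifferentiable_fin. Qed.

Lemma mirror_step (l : R) x y z : (0 < l)%R -> l%:E = rel_smoothness f X h ->
  X x -> X y ->
  argmin X (fun y =>
    (dotp (egradient f x) y)%:E + l%:E * bregman h y x) z ->
  (l * bregmanr h y z + (fine (f z) - fine (f y)) + bregmanr f y x
     <= l * bregmanr h y x)%R.
Proof.
move=> l0 lE Xx Xy zmin; have [Xz _] := zmin.
have := bregmanr_smooth f_fin h_fin lE Xx Xz
  (bregmanr_ge0 X_convex h_diff h_convex Xx Xz).
have := three_point X_convex h_diff l0 Xx Xy zmin.
have bE w : bregmanr f w x = (fine (f w) - fine (f x)
    - (dotp (egradient f x) w - dotp (egradient f x) x))%R.
  by rewrite -dotpBr.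
by rewrite !bE; lra.
Qed.

End MirrorDescent.

(** Here [a] stands for the distance to the solutions and [d] for the objective gap. Dropping [d]
    makes [a] decay geometrically; dropping [a k.+1] bounds [d k.+1] by [(l - m) * a k], and
    [l - m = l * (1 - m / l)] supplies the last power. The gap bound needs a preceding step, so it
    starts at index 1. *)
Lemma contraction_rate (R : realFieldType) (a d : nat -> R) (l m : R) :
  (0 < l)%R -> (m <= l)%R -> (forall k, 0 <= a k)%R -> (forall k, 0 <= d k)%R ->
  (forall k, l * a k.+1 + d k.+1 <= (l - m) * a k)%R ->
  (forall k, a k <= (1 - m / l) ^+ k * a 0%N)%R /\
  (forall k, d k.+1 <= l * (1 - m / l) ^+ k.+1 * a 0%N)%R.
Proof.
move=> l0 ml a0 d0 step.
have q0 : (0 <= 1 - m / l)%R by rewrite subr_ge0 ler_pdivrMr// mul1r.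
have lq : (l * (1 - m / l) = l - m)%R.
  by rewrite mulrBr mulr1 mulrCA mulfV ?mulr1// gt_eqF.
have aP k : (a k <= (1 - m / l) ^+ k * a 0%N)%R.
  elim: k => [|k IHk]; first by rewrite expr0 mul1r.
  rewrite exprS -mulrA; apply: le_trans (ler_wpM2l q0 IHk).
  rewrite -(ler_pM2l l0) mulrA lq; apply: le_trans (step k).
  by rewrite lerDl.
split=> // k; rewrite exprS mulrA lq -mulrA.
have ml0 : (0 <= l - m)%R by rewrite subr_ge0.
apply: le_trans (ler_wpM2l ml0 (aP k)); apply: le_trans (step k).
by rewrite lerDr mulr_ge0// ltW.
Qed.

Theorem proposition6 (R : realType) (n : nat)
    (f h : 'rV[R]_n -> \bar R) (X : set 'rV[R]_n)
    (f_neqNy : forall x, f x != -oo)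
    (f_convex : econvex_on setT f)
    (f_diff : forall x, edom f x -> edifferentiable f x)
    (X_dom : X `<=` edom f)
    (X_convex : convex_set X)
    (h_neqNy : forall x, h x != -oo)
    (h_convex : econvex_on X h)
    (h_diff : forall x, X x -> edifferentiable h x)
    (fstar_fin : minval f X \is a fin_num)
    (Xstar_neq0 : solset f X !=set0)
    (proj_wd : forall x, X x ->
      exists! y, argmin (solset f X) (bregman h ^~ x) y)
    (L mu : \bar R)
    (L_def : L = rel_smoothness f X h)
    (mu_def : mu = rel_quasi_strong_convexity f X h)
    (L_fin : L < +oo)
    (mu_gt0 : 0 < mu)
    (Lk : nat -> R)
    (Lk_gt0 : forall k, (0 < Lk k)%R)
    (Lk_L : forall k, (Lk k)%:E = L)
    (x : nat -> 'rV[R]_n)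
    (x0_X : X (x 0%N))
    (x_iter : mirror_descent f X h Lk x) :
  (forall k : nat,
     bregman_dist h (solset f X) (x k)
       <= (1 - mu / L) ^+ k * bregman_dist h (solset f X) (x 0%N)) /\
  (forall k : nat, (1 <= k)%N ->
     f (x k) - minval f X
       <= L * (1 - mu / L) ^+ k * bregman_dist h (solset f X) (x 0%N)).
Proof.
have f_fin y : X y -> f y \is a fin_num.
  by move=> /X_dom fy; rewrite fin_real// ltNye f_neqNy.
have h_fin y : X y -> h y \is a fin_num.
  by move=> /h_diff; exact: edifferentiable_fin.
have xX k : X (x k) by case: k => [//|k]; have [] := x_iter k.
pose l := Lk 0%N; have LE : L = l%:E by rewrite Lk_L.
have LkE k : Lk k = l by apply: EFin_inj; rewrite !Lk_L.
have l0 : (0 < l)%R by exact: Lk_gt0.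
have lE : l%:E = rel_smoothness f X h by rewrite -LE.
pose p k := bregman_proj h (solset f X) (x k).
have pmin k : argmin (solset f X) (bregman h ^~ (x k)) (p k).
  by apply: getPex; have [y [ymin _]] := proj_wd _ (xX k); exists y.
have pX k : X (p k) by have [[]] := pmin k.
have fp k : fine (f (p k)) = fine (minval f X) by have [[_ ->]] := pmin k.
pose a k := bregmanr h (p k) (x k).
pose b k := bregmanr f (p k) (x k).
pose d k := (fine (f (x k)) - fine (minval f X))%R.
have a0 k : (0 <= a k)%R by exact: (bregmanr_ge0 X_convex h_diff).
have d0 k : (0 <= d k)%R.
  rewrite subr_ge0 fine_le ?f_fin//.
  by apply: ereal_inf_lbound; exists (x k).
have distE k : bregman_dist h (solset f X) (x k) = (a k)%:E.
  by rewrite /bregman_dist (argmin_ereal_inf (pmin k)) bregmanE ?h_fin.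
have gapE k : f (x k) - minval f X = (d k)%:E.
  by rewrite -(fineK (f_fin _ (xX k))) -(fineK fstar_fin).
have [b0 mub] : (forall k, 0 <= b k)%R /\ forall k, mu * (a k)%:E <= (b k)%:E.
  suff H k : (0 <= b k)%R /\ mu * (a k)%:E <= (b k)%:E.
    by split=> k; have [] := H k.
  by rewrite mu_def; apply: (bregmanr_qsc f_fin h_fin _ (xX k) (pX k) (a0 k));
  rewrite -mu_def.
have step k : (l * a k.+1 + d k.+1 + b k <= l * a k)%R.
  have := x_iter k; rewrite LkE => kmin.
  have := mirror_step X_convex f_fin h_convex h_diff l0 lE (xX k) (pX k) kmin.
  (* The step inequality measures [x k.+1] from the old projection [p k], which is merely a
     competitor of the new projection [p k.+1]. *)
  have pk : (a k.+1 <= bregmanr h (p k) (x k.+1))%R.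
    rewrite -lee_fin -(bregmanE (h_fin _ (pX k.+1)) (h_fin _ (xX k.+1))).
    rewrite -(bregmanE (h_fin _ (pX k)) (h_fin _ (xX k.+1))).
    by have [_ lep] := pmin k.+1; have [Sp _] := pmin k; exact: lep.
  rewrite fp; apply: le_trans; rewrite lerD2r lerD2r.
  by rewrite ler_wpM2l// ltW.
suff main : (forall k, (a k)%:E <= (1 - mu / L) ^+ k * (a 0%N)%:E) /\
    (forall k, (d k.+1)%:E <= L * (1 - mu / L) ^+ k.+1 * (a 0%N)%:E).
  split=> [k|[//|k] _]; rewrite !distE; first exact: main.1.
  by rewrite gapE; exact: main.2.
(* When [a 0 = 0] the constant [mu] may be infinite; otherwise [mu <= L]. *)
have [a00|a0n0] := eqVneq (a 0%N) 0%R.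
  (* All terms of the step inequality are nonnegative, so it propagates 0 to every [a k] and
     [d k.+1]; the right-hand sides are 0 whatever the power of [1 - mu / L] is worth. *)
  have ak k : a k = 0%R.
    elim: k => // k IHk; apply/eqP; rewrite eq_le a0 andbT -(pmulr_rle0 _ l0).
    by move: (step k) (d0 k.+1) (b0 k); rewrite IHk mulr0; lra.
  split=> k; rewrite a00 mule0 ?ak// lee_fin.
  by move: (step k) (b0 k); rewrite !ak mulr0; lra.
have a0gt0 : (0 < a 0%N)%R by rewrite lt_neqAle eq_sym a0n0 a0.
(* The first iteration bounds [mu]: quasi-strong convexity gives [mu <= b 0 / a 0], and the step
   inequality gives [b 0 <= l * a 0]. So [mu] is finite and at most [L]. *)
have muba : mu <= (b 0%N / a 0%N)%:E by rewrite EFinM lee_pdivlMr ?mub.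
have bal : (b 0%N / a 0%N <= l)%R.
  rewrite ler_pdivrMr//; apply: le_trans (step 0%N).
  by rewrite lerDr addr_ge0// mulr_ge0// ltW.
have mu_fin : mu \is a fin_num.
  by rewrite ge0_fin_numE ?(le_lt_trans muba (ltry _))// ltW.
move: mu_fin mub muba => /fineK <-; set m := fine mu => mub muba.
have ml : (m <= l)%R by rewrite -lee_fin (le_trans muba)// lee_fin.
have stepm k : (l * a k.+1 + d k.+1 <= (l - m) * a k)%R.
  by move: (step k) (mub k); rewrite -EFinM lee_fin mulrBl; lra.
have qE k : (1 - m%:E / L) ^+ k = ((1 - m / l) ^+ k)%:E.
  by rewrite LE inver gt_eqF// -EFinM -EFinB EFin_expe.
have [aP dP] := contraction_rate l0 ml a0 d0 stepm.
by split=> k; rewrite qE ?LE -?EFinM lee_fin.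
Qed.
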